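(* Let $X\subseteq\mathbb R$ be an interval, let $Z$ be a normed space and let $g:X\to Z$ be a mapping. Then the following conditions are equivalent: (i) there exists a separately absolutely continuous mapping $f:X^2\to Z$ with diagonal $g$, i.e. $f(x,x)=g(x)$ for every $x\in X$; (ii) there exists a mapping $f:X^2\to Z$ with diagonal $g$ which is continuous with respect to the first variable (i.e. for every $y\in X$ the mapping $x\mapsto f(x,y)$ is continuous on $X$) and which has finite variation and is continuous with respect to the second variable at every point of $\Delta=\{(x,x):x\in X\}$ (i.e. for every $x\in X$ the mapping $f^x:X\to Z$, $f^x(t)=f(x,t)$, has finite variation at the point $x$ and is continuous at the point $x$); (iii) $g$ is an absolute Baire-one mapping.
   Context: The diagonal of a mapping $f:X^2\to Z$ is the mapping $g:X\to Z$, $g(x)=f(x,x)$. A mapping $h:X\to Z$ from an interval $X\subseteq\mathbb R$ to a metric space $Z$ (with metric $|\cdot-\cdot|_Z$; for a normed space, $|u-v|_Z=\|u-v\|$) is absolutely continuous if for every $\varepsilon>0$ there exists $\delta>0$ such that for every finite collection $a_1<b_1\le a_2<b_2\le\dots\le a_n<b_n$ of elements of $X$ with $\sum_{k=1}^n(b_k-a_k)<\delta$ one has $\sum_{k=1}^n|h(b_k)-h(a_k)|_Z<\varepsilon$. A mapping $f:X^2\to Z$ is separately absolutely continuous if it is absolutely continuous with respect to each variable (i.e. $x\mapsto f(x,y)$ is absolutely continuous for each fixed $y\in X$, and $y\mapsto f(x,y)$ is absolutely continuous for each fixed $x\in X$). A mapping $h$ has finite (bounded) variation on an interval $J$ if there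 is $C>0$ with $\sum_{k=1}^n|h(b_k)-h(a_k)|_Z\le C$ for every finite collection $a_1<b_1\le\dots\le a_n<b_n$ of elements of $J$. A mapping $h:X\to Z$ has finite variation at $x_0\in X$ if there is a segment $[a,b]\subseteq X$ which is a neighborhood of $x_0$ in $X$ and such that $h$ has finite variation on $[a,b]$. A mapping $h:X\to Z$ from a topological space $X$ to a metric space $Z$ is an absolute Baire-one mapping if there is a sequence $(h_n)_{n=1}^\infty$ of continuous mappings $h_n:X\to Z$ such that $\lim_{n\to\infty}h_n(x)=h(x)$ and $\sum_{n=1}^\infty|h_{n+1}(x)-h_n(x)|_Z<\infty$ for every $x\in X$. *)

(* Defs.v *)
From HB Require Import structures.
From mathcomp Require Import all_boot all_order all_algebra.
From mathcomp Require Import all_classical all_reals all_analysis.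
Set Implicit Arguments.
Unset Strict Implicit.
Unset Printing Implicit Defensive.
Import Order.TTheory GRing.Theory Num.Theory.
Import numFieldNormedType.Exports.
Local Open Scope classical_set_scope.
Local Open Scope ring_scope.

(* A mapping X -> Z (resp. X^2 -> Z) is represented by a total function
   R -> Z (resp. R -> R -> Z); only its values on X (resp. X^2) matter, and
   topological notions on X refer to the subspace topology of X. *)

(* a_0 < b_0 <= a_1 < b_1 <= ... <= a_(n-1) < b_(n-1), all in D *)
Definition itv_collection (R : realType) (D : set R) (n : nat)
    (a b : nat -> R) : Prop :=
  (forall k, (k < n)%N -> [/\ D (a k), D (b k) & a k < b k]) /\
  (forall k, (k.+1 < n)%N -> b k <= a k.+1).

Definition absolutely_continuous_on (R : realType) (Z : normedModType R)
    (X : set R) (h : R -> Z) : Prop :=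
  forall e : R, 0 < e -> exists2 d : R, 0 < d &
    forall (n : nat) (a b : nat -> R), itv_collection X n a b ->
      \sum_(k < n) (b k - a k) < d ->
      \sum_(k < n) `|h (b k) - h (a k)| < e.

Definition separately_absolutely_continuous (R : realType)
    (Z : normedModType R) (X : set R) (f : R -> R -> Z) : Prop :=
  (forall y, X y -> absolutely_continuous_on X (fun x => f x y)) /\
  (forall x, X x -> absolutely_continuous_on X (fun y => f x y)).

(* The library's [bounded_variation] only covers real-valued functions. *)
Definition finite_variation_on (R : realType) (Z : normedModType R)
    (J : set R) (h : R -> Z) : Prop :=
  exists2 C : R, 0 < C &
    forall (n : nat) (a b : nat -> R), itv_collection J n a b ->
      \sum_(k < n) `|h (b k) - h (a k)| <= C.

(* [a = b] is allowed; as [a, b] is a neighborhood of x0 in X, this can only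
   happen when the interval X is a single point. *)
Definition finite_variation_at (R : realType) (Z : normedModType R)
    (X : set R) (h : R -> Z) (x0 : R) : Prop :=
  exists a b : R, [/\ a <= b, `[a, b]%classic `<=` X,
    within X (nbhs x0) `[a, b]%classic & finite_variation_on `[a, b]%classic h].

Definition absolute_Baire_one (R : realType) (T : topologicalType)
    (Z : normedModType R) (X : set T) (h : T -> Z) : Prop :=
  exists hn : nat -> T -> Z,
    [/\ forall n, {within X, continuous (hn n)},
        forall x, X x -> hn n x @[n --> \oo] --> h x &
        forall x, X x -> cvgn (series (fun n => `|hn n.+1 x - hn n x|))].

Definition has_diagonal (R : realType) (Z : normedModType R) (X : set R)
    (f : R -> R -> Z) (g : R -> Z) : Prop :=
  forall x, X x -> f x x = g x.

(* Main.v *)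
(** (i) => (ii): an absolutely continuous map is continuous, and has variation
    at most 1 on every short segment.

    (ii) => (iii): let h_n(x) be the mean of f(x, Y), where Y is x + 2^-n rounded
    at random to the grid 2^-n Z with mean x + 2^-n; this is continuous in x. The
    roundings of successive levels are coupled so that Y decreases towards x.
    Hence |h_(n+1)(x) - h_n(x)| is at most the decrease of the mean of v(Y), v
    being the variation function of f(x, .) to the right of x, and these
    decreases telescope.

    (iii) => (i): the h_n can be replaced by Lipschitz maps k_n on the line. With
    d_n = k_(n+1) - k_n and e_n so small that the Lipschitz constant of d_n times
    e_n is at most 2^-n, put
      f(x, y) = k_0(x) + sum_n max(0, 1 - |x - y| / e_n) d_n(x).
    In each variable the n-th term is Lipschitz, with variation at most
    2 |d_n| + 4 * 2^-n at the fixed point, which is summable; and a sum of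
    absolutely continuous maps with summable variations is absolutely
    continuous. *)
Require Import Defs.
From HB Require Import structures.
From mathcomp Require Import all_boot all_order all_algebra.
From mathcomp Require Import all_classical all_reals all_analysis.
From mathcomp Require Import ring lra zify.
Set Implicit Arguments.
Unset Strict Implicit.
Unset Printing Implicit Defensive.
Import Order.TTheory GRing.Theory Num.Theory.
Import numFieldNormedType.Exports.
Local Open Scope classical_set_scope.
Local Open Scope ring_scope.

(** * The tent function and linear interpolation by its translates *)

Section Hat.
Variable R : realType.
Implicit Types s t : R.

Definition hat t : R := Num.max 0 (1 - `|t|).

Lemma hat_ge0 t : 0 <= hat t.
Proof. by rewrite /hat le_max lexx. Qed.

Lemma hat_le1 t : hat t <= 1.
Proof. by rewrite /hat ge_max ler01 /= lerBlDr lerDl. Qed.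

Lemma hat_out t : 1 <= `|t| -> hat t = 0.
Proof. by move=> t1; apply/max_l; rewrite subr_le0. Qed.

Lemma hatE t : `|t| <= 1 -> hat t = 1 - `|t|.
Proof. by move=> t1; apply/max_r; rewrite subr_ge0. Qed.

Lemma hat_lipschitz s t : `|hat s - hat t| <= `|s - t|.
Proof.
have := ler_dist_dist s t; rewrite /hat !ler_norml => /andP[? ?].
have [?|?] := leP (1 - `|s|) 0; have [?|?] := leP (1 - `|t|) 0;
  by apply/andP; lra.
Qed.

Lemma continuous_hat : continuous hat.
Proof.
move=> t; apply/cvgrPdist_lt => e e0; near=> s.
apply: le_lt_trans (hat_lipschitz _ _) _.
near: s; exact: cvgr_dist_lt.
Unshelve. all: by end_near. Qed.

(* At [t = k + theta] only the hats centred at [k] and [k + 1] are nonzero. *)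
Lemma sum_hat (Z : lmodType R) (u : nat -> Z) (m k : nat) (theta : R) :
  (k.+1 < m)%N -> 0 <= theta <= 1 ->
  \sum_(j < m) hat (k%:R + theta - j%:R) *: u j =
  (1 - theta) *: u k + theta *: u k.+1.
Proof.
move=> km /andP[th0 th1].
rewrite (bigD1 (Ordinal (ltnW km))) //= (bigD1 (Ordinal km)) /=; last first.
  by rewrite -val_eqE /= gtn_eqF.
rewrite big1 ?addr0 => [|j /andP[]]; last first.
  rewrite -!val_eqE /= => jk jk1; rewrite hat_out ?scale0r//.
  have [jltk|kj] := ltnP j k.
    have : j.+1%:R <= k%:R :> R by rewrite ler_nat.
    by rewrite -natr1 => ?; rewrite ger0_norm; lra.
  have : k.+2%:R <= j%:R :> R by rewrite ler_nat; lia.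
  by rewrite -!natr1 => ?; rewrite ler0_norm; lra.
have -> : k%:R + theta - k%:R = theta by ring.
have -> : k%:R + theta - k.+1%:R = - (1 - theta) by rewrite -natr1; ring.
by rewrite !hatE ?normrN ?ger0_norm ?subr_ge0 ?lerBlDr ?lerDl// subKr.
Qed.

End Hat.

(** * Variation functions and absolute continuity of sums *)

Section Variation.
Variables (R : realType) (Z : normedModType R).
Implicit Types (X D : set R) (h : R -> Z) (a b : nat -> R).

Definition variation_le X h (C : R) : Prop :=
  forall n a b, itv_collection X n a b ->
    \sum_(k < n) `|h (b k) - h (a k)| <= C.

Lemma itv_collectionW D m n a b : (m <= n)%N ->
  itv_collection D n a b -> itv_collection D m a b.
Proof.
move=> mn [Dab ba]; split=> k km; first by apply: Dab; exact: leq_trans mn.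
by apply: ba; exact: leq_trans mn.
Qed.

Lemma sub_itv_collection D X n a b : D `<=` X ->
  itv_collection D n a b -> itv_collection X n a b.
Proof. by move=> DX [Dab ba]; split=> // k /Dab[/DX ? /DX ? ?]. Qed.

(** Filling the gaps from [b k] to [a k.+1] adds nonnegative increments of [w], after which the sum
    telescopes. *)
Lemma sum_increments_le D (w : R -> R) (lo hi : R) n a b :
  (forall s t, D s -> D t -> s <= t -> w s <= w t) ->
  (forall t, D t -> lo <= w t <= hi) -> lo <= hi ->
  itv_collection D n a b -> \sum_(k < n) (w (b k) - w (a k)) <= hi - lo.
Proof.
move=> wmono wD lohi; case: n => [|n] ab; first by rewrite big_ord0 subr_ge0.
suff S : \sum_(k < n.+1) (w (b k) - w (a k)) <= w (b n) - w (a 0).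
  apply: le_trans S _; apply: lerB.
    by have [_ Db _] := ab.1 n (ltnSn _); have /andP[] := wD _ Db.
  by have [Da _ _] := ab.1 0 (ltn0Sn _); have /andP[] := wD _ Da.
elim: n ab => [|n IH] ab; first by rewrite big_ord_recl big_ord0 addr0.
rewrite big_ord_recr /=; have := IH (itv_collectionW (leqnSn _) ab).
have [Da _ _] := ab.1 n.+1 (ltnSn _).
have [_ Db _] := ab.1 n (ltnW (ltnSn _)).
by have := wmono _ _ Db Da (ab.2 n (ltnSn _)); lra.
Qed.

(** Here [w] acts as a variation function for [h]; the domination of increments already makes it
    nondecreasing on [X]. *)
Lemma variation_le_mono X h (w : R -> R) (lo hi : R) :
  (forall s t, X s -> X t -> s <= t -> `|h t - h s| <= w t - w s) ->
  (forall t, X t -> lo <= w t <= hi) -> lo <= hi ->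
  variation_le X h (hi - lo).
Proof.
move=> hw wX lohi n a b ab; apply: le_trans (sum_increments_le _ wX lohi ab).
  apply: ler_sum => k _; have [Xa Xb lt_ab] := ab.1 _ (ltn_ord k).
  exact: hw (ltW _).
move=> s t Xs Xt st; rewrite -subr_ge0.
by apply: le_trans (hw _ _ Xs Xt st).
Qed.

(** Take for [v t] the total variation of [h] on [[p, t]]: appending [[s, t]] to any collection in
    [[p, s]] gives a collection in [[p, t]]. *)
Lemma finite_variation_majorant (p q : R) h :
  finite_variation_on `[p, q] h ->
  exists v : R -> R, forall s t, p <= s -> s <= t -> t <= q ->
    `|h t - h s| <= v t - v s.
Proof.
move=> [C C0 hC].
pose A t := [set S | exists n a b, itv_collection `[p, t] n a b /\
  S = \sum_(k < n) `|h (b k) - h (a k)|].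
have Aub t : t <= q -> has_ubound (A t).
  move=> tq; exists C => _ [n [a [b [ab ->]]]]; apply: hC.
  apply: sub_itv_collection ab => z /=; rewrite !in_itv /= => /andP[-> zt].
  exact: le_trans tq.
exists (fun t => sup (A t)) => s t ps st tq /=.
(* The appended interval must be nondegenerate to belong to a collection. *)
have [->|neq_st] := eqVneq s t; first by rewrite !subrr normr0.
have {neq_st}lt_st : s < t by rewrite lt_neqAle neq_st.
rewrite lerBrDl -lerBrDr; apply: ge_sup.
  by exists 0, 0%N, (fun=> 0), (fun=> 0); rewrite big_ord0.
move=> _ [n [a [b [ab ->]]]]; rewrite lerBrDr; apply: ub_le_sup; first exact: Aub.
exists n.+1, (fun k => if (k < n)%N then a k else s),
  (fun k => if (k < n)%N then b k else t); split; last first.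
  rewrite big_ord_recr /= ltnn; congr (_ + _).
  by apply: eq_bigr => k _; rewrite ltn_ord.
split=> k.
  rewrite ltnS leq_eqVlt; have [kn _|nk] := ltnP k n; last first.
    by rewrite /= !in_itv /= ps lexx st (le_trans ps).
  have [/= + + ?] := ab.1 _ kn; rewrite !in_itv /=.
  by move=> /andP[? ?] /andP[? ?]; split => //; apply/andP; split => //; lra.
rewrite ltnS => kn; rewrite kn; case: ltnP => [/ab.2//|_].
by have [_ /=] := ab.1 _ kn; rewrite in_itv /= => /andP[].
Qed.

Lemma absolutely_continuous_onD X h1 h2 :
  absolutely_continuous_on X h1 -> absolutely_continuous_on X h2 ->
  absolutely_continuous_on X (fun x => h1 x + h2 x).
Proof.
move=> h1X h2X e e0; have e20 : 0 < e / 2 by lra.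
have [d1 d10 hd1] := h1X _ e20; have [d2 d20 hd2] := h2X _ e20.
exists (Num.min d1 d2); first by rewrite lt_min d10 d20.
move=> n a b ab; rewrite lt_min => /andP[sd1 sd2].
have := ltrD (hd1 n a b ab sd1) (hd2 n a b ab sd2).
rewrite -splitr -big_split /=; apply: le_lt_trans; apply: ler_sum => k _.
by rewrite opprD addrACA ler_normD.
Qed.

Lemma absolutely_continuous_on_lipschitz X h (L : R) :
  (forall s t, X s -> X t -> `|h t - h s| <= L * `|t - s|) ->
  absolutely_continuous_on X h.
Proof.
(* The maximum with 1 makes the divisor positive whatever the sign of [L]. *)
move=> hL e e0; pose M := Num.max L 1.
have M0 : 0 < M by rewrite lt_max ltr01 orbT.
exists (e / M); first exact: divr_gt0.
move=> n a b ab; rewrite ltr_pdivlMr// mulrC mulr_sumr; apply: le_lt_trans.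
apply: ler_sum => k _; have [Xa Xb lt_ab] := ab.1 _ (ltn_ord k).
apply: le_trans (hL _ _ Xa Xb) _; rewrite gtr0_norm ?subr_gt0//.
by rewrite ler_wpM2r ?subr_ge0 ?(ltW lt_ab)// le_max lexx.
Qed.

Lemma absolutely_continuous_on_sum X (F : nat -> R -> Z) N :
  (forall i, absolutely_continuous_on X (F i)) ->
  absolutely_continuous_on X (fun x => \sum_(0 <= i < N) F i x).
Proof.
move=> FX; elim: N => [|N IH].
  apply: (@absolutely_continuous_on_lipschitz _ _ 0) => s t _ _.
  by rewrite !big_geq// subrr normr0 mul0r.
rewrite (_ : (fun x => _) =
    (fun x => \sum_(0 <= i < N) F i x + F N x)); last first.
  by apply/funext => x; rewrite big_nat_recr.
exact: absolutely_continuous_onD.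
Qed.

(** Summability of [v] makes the variation of a tail small uniformly over all collections; the
    remaining finite sum is absolutely continuous. *)
Lemma absolutely_continuous_on_series X (F : nat -> R -> Z) (v : nat -> R) h :
  (forall i, absolutely_continuous_on X (F i)) ->
  (forall i, variation_le X (F i) (v i)) -> cvgn (series v) ->
  (forall x, X x -> series (F ^~ x) n @[n --> \oo] --> h x) ->
  absolutely_continuous_on X h.
Proof.
move=> FX Fv vcvg Fh e e0; have e40 : 0 < e / 4 by lra.
have [N tail] : exists N, forall m, (N <= m)%N -> \sum_(N <= i < m) v i < e / 4.
  have /cvg_cauchy/cauchy_seriesP/(_ _ e40) := vcvg.
  move=> [[A B] /= [[N1 _ N1A] [N2 _ N2B]] AB].
  exists (maxn N1 N2) => m Nm; apply: le_lt_trans (ler_norm _) _.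
  apply: (AB (_, m)); split; [apply: N1A|apply: N2B] => /=.
    exact: leq_maxl.
  by apply: leq_trans Nm; exact: leq_maxr.
have [d d0 hd] := absolutely_continuous_on_sum N FX e40.
exists d => // n a b ab sd.
(* The estimate is shown for partial sums and passed to the limit, which keeps only a weak
   inequality; hence the margin [e / 2]. *)
suff : \sum_(k < n) `|h (b k) - h (a k)| <= e / 2 by lra.
have cv : \sum_(k < n) `|series (F ^~ (b k)) m - series (F ^~ (a k)) m|
    @[m --> \oo] --> \sum_(k < n) `|h (b k) - h (a k)|.
  apply: cvg_big => //; first exact: add_continuous.
  move=> k _; have [Xa Xb _] := ab.1 _ (ltn_ord k).
  by apply: cvg_norm; apply: cvgB; exact: Fh.
apply: (cvgr_to_le cv); near=> m.
have Nm : (N <= m)%N by near: m; exact: nbhs_infty_ge.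
have tailm : \sum_(k < n) \sum_(N <= i < m) `|F i (b k) - F i (a k)| <= e / 4.
  apply: le_trans (ltW (tail _ Nm)).
  by rewrite exchange_big /=; apply: ler_sum => i _; exact: Fv.
have := hd _ _ _ ab sd.
suff : \sum_(k < n) `|series (F ^~ (b k)) m - series (F ^~ (a k)) m| <=
    \sum_(k < n) `|\sum_(0 <= i < N) F i (b k) - \sum_(0 <= i < N) F i (a k)| +
    \sum_(k < n) \sum_(N <= i < m) `|F i (b k) - F i (a k)| by lra.
rewrite -big_split /=; apply: ler_sum => k _; rewrite !seriesEnat /=.
rewrite !(big_cat_nat (leq0n N) Nm) /= opprD addrACA.
apply: le_trans (ler_normD _ _) _; apply: lerD => //.
by rewrite -sumrB; apply: ler_norm_sum.
Unshelve. all: by end_near. Qed.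

(* A map supported on [y - e, y + e] factors through the projection of the
   line onto that segment. *)
Lemma lipschitz_bump X h (y e K : R) : 0 < e -> 0 <= K ->
  (forall x, e <= `|x - y| -> h x = 0) ->
  (forall s t, `|s - y| <= e -> `|t - y| <= e -> `|h t - h s| <= K * `|t - s|) ->
  absolutely_continuous_on X h /\ variation_le X h (2 * e * K).
Proof.
move=> e0 K0 hout hK.
pose c t := Num.max (y - e) (Num.min (y + e) t).
have cP t : h t = h (c t) /\ `|c t - y| <= e.
  have ye : `|y + e - y| = e by rewrite addrAC subrr add0r gtr0_norm.
  have yNe : `|y - e - y| = e by rewrite addrAC subrr add0r normrN gtr0_norm.
  rewrite /c; have [et|te] := leP (y + e) t.
    rewrite max_r ?ye ?lexx; last lra.
    by rewrite !hout ?ye// ger0_norm; lra.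
  have [te'|et] := leP t (y - e).
    by rewrite !hout ?yNe// ?lexx// ler0_norm; lra.
  by split=> //; rewrite ler_norml; lra.
have cmono s t : s <= t -> 0 <= c t - c s <= t - s.
  move=> st; rewrite /c.
  have [?|?] := leP (y + e) t; have [?|?] := leP (y + e) s;
    rewrite ?[Num.max (y - e) (y + e)]max_r; try lra.
    by have [?|?] := leP s (y - e); lra.
  by have [?|?] := leP t (y - e); have [?|?] := leP s (y - e); lra.
have hc s t : s <= t -> `|h t - h s| <= K * c t - K * c s.
  move=> st; have [-> ct] := cP t; have [-> cs] := cP s.
  apply: le_trans (hK _ _ cs ct) _; rewrite -mulrBr ger0_norm//.
  by have /andP[] := cmono _ _ st.
split.
  apply: (@absolutely_continuous_on_lipschitz _ _ K) => s t _ _.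
  wlog st : s t / s <= t.
    move=> H; have /orP[/H//|/H] := le_total s t.
    by rewrite distrC [`|s - t|]distrC.
  apply: le_trans (hc _ _ st) _; rewrite -mulrBr ger0_norm ?subr_ge0//.
  by rewrite ler_wpM2l//; have /andP[] := cmono _ _ st.
have -> : 2 * e * K = K * (y + e) - K * (y - e) by ring.
apply: (@variation_le_mono _ _ (fun t => K * c t)) => [s t _ _|t _|].
- exact: hc.
- by have [_] := cP t; rewrite ler_norml => ?; rewrite !ler_wpM2l//; lra.
- by rewrite ler_wpM2l//; lra.
Qed.

(** Product rule on the support: the hat is bounded by 1 and [1 / e]-Lipschitz, while [d] is
    [M]-Lipschitz and bounded by [|d y| + M * e]. The product thus has Lipschitz constant
    [|d y| / e + 2 * M] there, on a segment of length [2 * e]. *)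
Lemma hat_bump X (d : R -> Z) (y e M : R) : 0 < e -> 0 <= M ->
  (forall s t, `|d t - d s| <= M * `|t - s|) ->
  absolutely_continuous_on X (fun x => hat ((x - y) / e) *: d x) /\
  variation_le X (fun x => hat ((x - y) / e) *: d x) (2 * `|d y| + 4 * (M * e)).
Proof.
move=> e0 M0 dM.
have -> : 2 * `|d y| + 4 * (M * e) = 2 * e * (`|d y| / e + 2 * M).
  by field; rewrite gt_eqF.
have n_div x : `|(x - y) / e| = `|x - y| / e.
  by rewrite normrM normfV (gtr0_norm e0).
apply: (@lipschitz_bump _ _ y) => //.
- by rewrite addr_ge0 ?divr_ge0 ?mulr_ge0// ltW.
- by move=> x ex; rewrite hat_out ?scale0r// n_div ler_pdivlMr// mul1r.
move=> s t sy ty.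
have -> : hat ((t - y) / e) *: d t - hat ((s - y) / e) *: d s =
    (hat ((t - y) / e) - hat ((s - y) / e)) *: d t +
    hat ((s - y) / e) *: (d t - d s).
  by rewrite scalerBl scalerBr addrA subrK.
apply: le_trans (ler_normD _ _) _; rewrite !normrZ.
have hl : `|hat ((t - y) / e) - hat ((s - y) / e)| <= `|t - s| / e.
  apply: le_trans (hat_lipschitz _ _) _.
  by rewrite -mulrBl normrM normfV (gtr0_norm e0) opprB addrA subrK.
have dt : `|d t| <= `|d y| + M * e.
  rewrite -[d t](subrK (d y)) addrC; apply: le_trans (ler_normD _ _) _.
  by rewrite lerD2l; apply: le_trans (dM _ _) _; rewrite ler_wpM2l.
have -> : (`|d y| / e + 2 * M) * `|t - s| =
    `|t - s| / e * (`|d y| + M * e) + 1 * (M * `|t - s|).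
  by field; rewrite gt_eqF.
apply: lerD; apply: ler_pM => //.
by rewrite ger0_norm ?hat_ge0// hat_le1.
Qed.

End Variation.

(** * Exhaustion of an interval by segments, and Lipschitz approximation *)

Section Approximation.
Variables (R : realType) (Z : normedModType R).
Implicit Types (X : set R) (h : R -> Z).

(* [p] is the identity on [X] and sends the points beyond a maximum of [X], if
   there is one, to this maximum. *)
Lemma right_retraction X (x0 : R) : is_interval X -> X x0 ->
  exists p : R -> R, (forall y, X (p y)) /\
    forall x, X x -> exists2 d : R, 0 < d &
      forall s t, x <= s -> s <= t -> t <= x + d ->
        [/\ x <= p s, p s <= p t & p t <= t].
Proof.
move=> X_itv Xx0.
have [m [Xm mmax]] : exists m, X m /\
    forall z, X z -> (forall y, X y -> y <= z) -> m = z.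
  have [[m [Xm mX]]|nomax] := pselect (exists m, X m /\ forall y, X y -> y <= m).
    exists m; split=> // z Xz zX; apply/eqP; rewrite eq_le.
    by rewrite mX// zX.
  by exists x0; split=> // z Xz zX; case: nomax; exists z.
exists (fun y => if y \in X then y else m); split=> [y|x Xx].
  by case: ifPn => //; rewrite inE.
have [xX|] := pselect (forall y, X y -> y <= x).
  have -> := mmax _ Xx xX; exists 1 => // s t xs st _.
  have P u : x <= u -> (if u \in X then u else x) = x.
    case: ifPn => //; rewrite inE => /xX ux xu.
    by apply/eqP; rewrite eq_le ux.
  by rewrite !P ?(le_trans xs st).
move=> /existsNP[z /not_implyP[Xz /negP]]; rewrite -ltNge => xz.
exists (z - x); first by rewrite subr_gt0.
have P u : x <= u <= z -> u \in X by move=> /(X_itv _ _ Xx Xz); rewrite inE.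
by move=> s t xs st; rewrite addrC subrK => tz; rewrite !P; try split; lra.
Qed.

(** Running maxima of the retracted rationals. A rational slightly to the right of [x] is retracted
    to a point not below [x], also when [x] is the maximum of [X]. *)
Lemma cofinal_sequence X (x0 : R) : is_interval X -> X x0 ->
  exists b : nat -> R, (forall n, X (b n)) /\
    forall x, X x -> \forall n \near \oo, x <= b n.
Proof.
move=> X_itv Xx0; have [p [Xp pX]] := right_retraction X_itv Xx0.
(* Indices that code no rational are read as 0; this is harmless, as [p] still lands in [X]. *)
pose c i := p (ratr (odflt 0 (unpickle i : option rat))).
exists (fun n => \big[Num.max/x0]_(i < n) c i); split=> [n|x Xx].
  elim/big_ind: _ => [//|u v Xu Xv|i _]; last exact: Xp.
  by rewrite /Order.max; case: ifP.
have [d d0 xP] := pX _ Xx.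
have [q] := @rat_in_itvoo _ x (x + d) ltac:(lra).
rewrite in_itv /= => /andP[xq qx].
exists (pickle q).+1 => // n /= qn.
apply: (@le_trans _ _ (c (pickle q))); last exact: (le_bigmax _ _ (Ordinal qn)).
by rewrite /c pickleK /=; have [] := xP _ _ (ltW xq) (lexx _) (ltW qx).
Qed.

Lemma segment_exhaustion X (x0 : R) : is_interval X -> X x0 ->
  exists a b : nat -> R, (forall n, `[a n, b n] `<=` X) /\
    forall x, X x -> \forall n \near \oo, x \in `[a n, b n].
Proof.
move=> X_itv Xx0; have [b [Xb bX]] := cofinal_sequence X_itv Xx0.
have NX_itv : is_interval (X \o -%R).
  by move=> x y Xx Xy z zxy; apply: (X_itv _ _ Xy Xx); rewrite !lerN2 andbC.
have NXx0 : (X \o -%R) (- x0) by rewrite /= opprK.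
have [a [Xa aX]] := cofinal_sequence NX_itv NXx0.
exists (fun n => - a n), b; split=> [n z /=|x Xx].
  by rewrite in_itv /=; exact: X_itv (Xa n) (Xb n) _.
have NXx : (X \o -%R) (- x) by rewrite /= opprK.
near=> n; rewrite in_itv /= lerNl; apply/andP; split; near: n.
  exact: aX.
exact: bX.
Unshelve. all: by end_near. Qed.

(** Heine-Cantor, from the near-covering form of compactness with the modulus, tending to 0 from the
    right, as parameter. *)
Lemma segment_uniform_continuity (a b e : R) h :
  {within `[a, b], continuous h} -> 0 < e ->
  exists2 d : R, 0 < d & forall s t, s \in `[a, b] -> t \in `[a, b] ->
    `|s - t| < d -> `|h s - h t| <= e.
Proof.
move=> /subspace_continuousP ch e0; have e20 : 0 < e / 2 by lra.
have /compact_near_coveringP cov := @segment_compact R a b.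
have /= := cov R 0^'+ (fun d s => forall t, s \in `[a, b] -> t \in `[a, b] ->
  `|s - t| < d -> `|h s - h t| <= e) _ _.
case=> [x abx|r /= r0 rP].
  have /cvgrPdist_lt/(_ _ e20) := ch _ abx.
  move=> /nbhs_ballP[r /= r0 rP]; have r20 : 0 < r / 2 by lra.
  near=> s d => t sab tab std.
  have sx : `|x - s| < r / 2 by near: s; exact: nbhsx_ballx.
  have dr : d < r / 2 by near: d; exact: nbhs_right_lt.
  have hs : `|h x - h s| < e / 2 by apply: rP => //; rewrite /ball /=; lra.
  have ht : `|h x - h t| < e / 2.
    apply: rP => //; rewrite /ball /=.
    rewrite [r]splitr; apply: le_lt_trans (ler_distD s _ _) _.
    by rewrite ltrD// (lt_trans std).
  rewrite [e]splitr; apply: le_trans (ler_distD (h x) _ _) _.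
  by rewrite distrC lerD// ltW.
exists (r / 2); first lra.
have r20 : 0 < r / 2 by lra.
move=> s t sab tab st; apply: (rP (r / 2)) => //=.
by rewrite sub0r normrN gtr0_norm; lra.
Unshelve. all: by end_near. Qed.

(** Piecewise linear interpolation on a grid finer than the modulus of uniform continuity: at each
    point of the segment the value is a convex combination of two nearby samples. *)
Lemma lipschitz_approximation (a b e : R) h :
  {within `[a, b], continuous h} -> 0 < e ->
  exists (k : R -> Z) (L : R), [/\ 0 <= L,
    forall s t, `|k t - k s| <= L * `|t - s| &
    forall x, x \in `[a, b] -> `|k x - h x| <= e].
Proof.
move=> ch e0; have [d d0 dP] := segment_uniform_continuity ch e0.
pose w := d / 2; have w0 : 0 < w by rewrite /w; lra.
(* Two extra indices ensure that both grid neighbours of every point of the segment are summed over;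
   the samples beyond [b] are taken at [b]. *)
pose m := (Num.truncn ((b - a) / w)).+2.
pose u j := h (Num.min b (a + j%:R * w)).
exists (fun x => \sum_(j < m) hat ((x - a) / w - j%:R) *: u j).
exists (\sum_(j < m) w^-1 * `|u j|).
split=> [|s t|].
  by apply: sumr_ge0 => j _; rewrite mulr_ge0// invr_ge0 ltW.
  rewrite -sumrB mulr_suml; apply: le_trans (ler_norm_sum _ _ _) _.
  apply: ler_sum => j _; rewrite -scalerBl normrZ mulrAC ler_wpM2r//.
  apply: le_trans (hat_lipschitz _ _) _.
  have -> : (t - a) / w - j%:R - ((s - a) / w - j%:R) = w^-1 * (t - s) by ring.
  by rewrite normrM gtr0_norm// invr_gt0.
move=> x; rewrite in_itv /= => /andP[ax xb].
pose k := Num.truncn ((x - a) / w); pose th := (x - a) / w - k%:R.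
have xaw0 : 0 <= (x - a) / w by rewrite divr_ge0 ?subr_ge0// ltW.
have /andP[kx xk] : k%:R <= (x - a) / w < k.+1%:R by exact: truncn_itv.
have th01 : 0 <= th <= 1 by rewrite /th -natr1 in xk *; lra.
have km : (k.+1 < m)%N.
  rewrite /m !ltnS; apply: le_truncn.
  by rewrite ler_wpM2r ?invr_ge0 ?(ltW w0)//; lra.
have -> : (x - a) / w = k%:R + th by rewrite /th; ring.
rewrite sum_hat//.
have xE : x = a + k%:R * w + th * w.
  by rewrite /th; field; rewrite gt_eqF.
have thw : 0 <= th * w <= w by rewrite mulr_ge0 ?ler_piMl ?(ltW w0)//; lra.
have k0 : 0 <= k%:R * w by rewrite mulr_ge0// ltW.
have close j : `|x - (a + j%:R * w)| < d -> 0 <= j%:R * w -> `|u j - h x| <= e.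
  move=> xj j0; apply: dP; rewrite ?in_itv /= ?ax ?xb//.
    by rewrite le_min ge_min lexx /=; lra.
  move: xj; rewrite !ltr_norml => /andP[? ?].
  by have [?|?] := leP b (a + j%:R * w); apply/andP; lra.
have wd : w < d by rewrite /w; lra.
move: thw => /andP[thw0 thw1].
have c0 : `|u k - h x| <= e.
  by apply: close => //; rewrite ltr_norml; apply/andP; lra.
have c1 : `|u k.+1 - h x| <= e.
  apply: close; rewrite -natr1 mulrDl mul1r; last lra.
  by rewrite ltr_norml; apply/andP; lra.
have -> : (1 - th) *: u k + th *: u k.+1 - h x =
    (1 - th) *: (u k - h x) + th *: (u k.+1 - h x).
  rewrite !scalerBr addrACA -opprD -scalerDl.
  by rewrite (_ : 1 - th + th = 1) ?scale1r//; ring.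
apply: le_trans (ler_normD _ _) _; rewrite !normrZ !ger0_norm; [|lra..].
have -> : e = (1 - th) * e + th * e by ring.
by apply: lerD; apply: ler_wpM2l => //; lra.
Qed.

End Approximation.

(** * From absolute Baire-one maps to separately absolutely continuous ones *)

Section Diagonal.
Variables (R : realType) (Z : normedModType R).
Implicit Types (X : set R).

Lemma is_cvg_series_bounded (u : nat -> R) (N : nat) (C : R) :
  (forall n, 0 <= u n) -> (forall n, \sum_(N <= i < n) u i <= C) ->
  cvgn (series u).
Proof.
move=> u0 uC; rewrite -(is_cvg_series_restrict N).
apply: nondecreasing_is_cvgn; last by exists C => _ [n _ <-]; exact: uC.
move=> m n mn /=; have [nN|Nn] := leqP n N.
  by rewrite !big_geq ?(leq_trans mn).
have [mN|Nm] := leqP m N; first by rewrite big_geq ?sumr_ge0.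
by rewrite (big_cat_nat (ltnW Nm) mn) /= lerDl sumr_ge0.
Qed.

Lemma is_cvg_series_le_near (u v : nat -> R) :
  (forall n, 0 <= u n) -> (\forall n \near \oo, u n <= v n) ->
  cvgn (series v) -> cvgn (series u).
Proof.
move=> u0 [N _ uv]; rewrite -(is_cvg_series_restrict N) => /cvg_seq_bounded.
move=> [B [Breal vB]]; apply: (@is_cvg_series_bounded u N (B + 1)) => // n.
apply: (@le_trans _ _ (\sum_(N <= i < n) v i)).
  rewrite big_nat_cond [leRHS]big_nat_cond; apply: ler_sum => i.
  by move=> /andP[/andP[Ni _] _]; exact: uv.
by apply: le_trans (ler_norm _) _; apply: (vB (B + 1)) => //; rewrite ltrDl.
Qed.

Lemma is_cvg_series_half (c : R) : cvgn (series (fun n => c * 2^-1 ^+ n)).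
Proof. by apply: is_cvg_geometric_series; rewrite ger0_norm; lra. Qed.

(** Approximate the n-th map within [2^-1 ^+ n] on the n-th segment of an exhaustion of [X]. Each
    point lies in all late segments, so the errors there are eventually summable. *)
Lemma absolute_Baire_one_lipschitz X (x0 : R) (g : R -> Z) :
  is_interval X -> X x0 -> absolute_Baire_one X g ->
  exists (k : nat -> R -> Z) (M : nat -> R), [/\ forall n, 0 <= M n,
    forall n s t, `|k n t - k n s| <= M n * `|t - s|,
    forall x, X x -> k n x @[n --> \oo] --> g x &
    forall x, X x -> cvgn (series (fun n => `|k n.+1 x - k n x|))].
Proof.
move=> X_itv Xx0 [h [hc hg hs]].
have [a [b [abX abP]]] := segment_exhaustion X_itv Xx0.
have e0 n : 0 < 2^-1 ^+ n :> R by rewrite exprn_gt0// invr_gt0.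
have happ n := lipschitz_approximation (continuous_subspaceW (abX n) (hc n)) (e0 n).
have [k kE] := choice happ; have [M kM] := choice kE.
have near_kh x : X x -> \forall n \near \oo, `|k n x - h n x| <= 2^-1 ^+ n.
  move=> Xx; near=> n; have [_ _] := kM n; apply.
  by near: n; exact: abP.
exists k, M; split.
- by move=> n; have [] := kM n.
- by move=> n; have [] := kM n.
- move=> x Xx; rewrite (_ : (fun n => _) = (fun n => k n x - h n x + h n x)).
    rewrite -[g x]add0r; apply: cvgD; last exact: hg.
    apply/norm_cvg0P; apply: (@squeeze_cvgr _ _ _ _ (fun=> 0) (GRing.exp 2^-1)).
    - by near=> n; rewrite normr_ge0 /=; near: n; exact: near_kh.
    - exact: cvg_cst.
    - by apply: cvg_expr; rewrite ger0_norm; lra.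
  by apply/funext => n; rewrite subrK.
- move=> x Xx; apply: (@is_cvg_series_le_near _
    (fun n => `|h n.+1 x - h n x| + 2 * 2^-1 ^+ n)) => //.
    near=> n.
    have kh : `|k n x - h n x| <= 2^-1 ^+ n by near: n; exact: near_kh.
    have kh1 : `|k n.+1 x - h n.+1 x| <= 2^-1 ^+ n.+1.
      near: n; have [N _ NP] := near_kh _ Xx.
      by exists N => // n /= Nn; apply: NP; exact: leqW.
    have := ler_distD (h n.+1 x) (k n.+1 x) (k n x).
    have := ler_distD (h n x) (h n.+1 x) (k n x).
    rewrite [`|h n x - k n x|]distrC; move: kh1; rewrite exprS.
    by have := e0 n; lra.
  rewrite (_ : series _ = series (fun n => `|h n.+1 x - h n x|) +
      series (fun n => 2 * 2^-1 ^+ n)).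
    by apply: is_cvgD; [exact: hs|exact: is_cvg_series_half].
  by apply/funext => n; rewrite !fctE !seriesEnat /= big_split.
Unshelve. all: by end_near. Qed.

(* The support of the n-th term shrinks to the diagonal, where the series sums
   to [g]; off the diagonal the sum is finite. *)
Lemma absolute_Baire_one_diagonal X (x0 : R) (g : R -> Z) :
  is_interval X -> X x0 -> absolute_Baire_one X g ->
  exists f : R -> R -> Z,
    separately_absolutely_continuous X f /\ has_diagonal X f g.
Proof.
move=> X_itv Xx0 /(absolute_Baire_one_lipschitz X_itv Xx0).
move=> [k [M [M0 kM kg ks]]].
pose d n x := k n.+1 x - k n x; pose L n := M n.+1 + M n.
have L0 n : 0 <= L n by rewrite addr_ge0.
have dL n s t : `|d n t - d n s| <= L n * `|t - s|.
  rewrite /d opprD addrACA -opprD mulrDl.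
  apply: le_trans (ler_normB _ _) _.
  exact: lerD.
(* The added 1 keeps the divisor positive and gives [e n <= 2^-1 ^+ n] along with the same bound for
   [L n * e n]. *)
pose e n := 2^-1 ^+ n / (L n + 1).
have pow0 n : 0 < 2^-1 ^+ n :> R by rewrite exprn_gt0// invr_gt0.
have L1 n : 0 < L n + 1 by have := L0 n; lra.
have e0 n : 0 < e n by rewrite divr_gt0.
have e_le n : e n <= 2^-1 ^+ n.
  by rewrite ler_pdivrMr//; have := L0 n; have := pow0 n; nra.
have Le n : L n * e n <= 2^-1 ^+ n.
  by rewrite mulrA ler_pdivrMr//; have := L0 n; have := pow0 n; nra.
pose F n x y := hat ((x - y) / e n) *: d n x.
pose S x y := limn (series (fun n => F n x y)).
have Sdiag x : X x -> series (fun n => F n x x) n @[n --> \oo] --> g x - k 0 x.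
  (* All hats equal 1 on the diagonal, so the partial sums telescope. *)
  move=> Xx; rewrite (_ : (fun n => _) = (fun n => k n x - k 0 x)).
    by apply: cvgB; [exact: kg|exact: cvg_cst].
  apply/funext => n; rewrite seriesEnat /= -(telescope_sumr (k ^~ x))//.
  apply: eq_bigr => i _; rewrite /F subrr mul0r hatE ?normr0 ?ler01//.
  by rewrite subr0 scale1r.
have Soff x y : x != y -> cvgn (series (fun n => F n x y)).
  move=> xy; have xy0 : 0 < `|x - y| by rewrite normr_gt0 subr_eq0.
  have [N _ NP] : \forall n \near \oo, e n <= `|x - y|.
    have /cvgrPdist_lt/(_ _ xy0) : 2^-1 ^+ n @[n --> \oo] --> (0 : R).
      by apply: cvg_expr; rewrite ger0_norm; lra.
    apply: filterS => n; rewrite sub0r normrN gtr0_norm// => /ltW.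
    exact: le_trans.
  rewrite -(is_cvg_series_restrict N); apply/cvg_ex; exists 0.
  apply: cvg_near_cst; apply: nearW => n /=.
  rewrite big_nat_cond big1// => i /andP[/andP[Ni _] _].
  rewrite /F hat_out ?scale0r// normrM normfV (gtr0_norm (e0 i)).
  by rewrite ler_pdivlMr// mul1r; exact: NP.
have SP x y : X x -> series (fun n => F n x y) n @[n --> \oo] --> S x y.
  move=> Xx; have [<-|/Soff//] := eqVneq x y.
  by have := cvgP _ (Sdiag _ Xx).
exists (fun x y => k 0 x + S x y); split; last first.
  move=> x Xx; have -> : S x x = g x - k 0 x by exact/cvg_lim/Sdiag.
  by rewrite addrC subrK.
split=> [y Xy|x Xx].
  apply: absolutely_continuous_onD.
    by apply: (@absolutely_continuous_on_lipschitz _ _ _ _ (M 0)) => s t _ _.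
  have bump n := hat_bump X y (e0 n) (L0 n) (dL n).
  apply: (@absolutely_continuous_on_series _ _ _ (fun n => F n ^~ y)
    (fun n => 2 * `|d n y| + 4 * (L n * e n))) => [n|n||x Xx].
  - by have [] := bump n.
  - by have [] := bump n.
  - apply: (@is_cvg_series_le_near _
      (fun n => 2 * `|d n y| + 4 * 2^-1 ^+ n)) => [n||].
        by apply: addr_ge0; rewrite mulr_ge0// mulr_ge0// ltW.
      by near=> n; rewrite lerD2l ler_wpM2l.
    rewrite (_ : series _ = 2 *: series (fun n => `|d n y|) +
        series (fun n => 4 * 2^-1 ^+ n)).
      apply: is_cvgD; last exact: is_cvg_series_half.
      by apply: is_cvgZr; exact: ks.
    apply/funext => n.
    by rewrite !fctE !seriesEnat /= big_split /= -mulr_sumr.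
  - exact: SP.
apply: absolutely_continuous_onD.
  apply: (@absolutely_continuous_on_lipschitz _ _ _ _ 0) => s t _ _.
  by rewrite subrr normr0 mul0r.
(* In the second variable the factor [d n x] is constant, so its Lipschitz constant is taken to be
   0. *)
have bump n := @hat_bump R Z X (fun=> d n x) x (e n) 0 (e0 n) (lexx _).
have Fsym n : F n x = fun y => hat ((y - x) / e n) *: d n x.
  apply/funext => y; rewrite /F -[x - y]opprB mulNr; congr (_ *: _).
  by rewrite /hat normrN.
apply: (@absolutely_continuous_on_series _ _ _ (fun n => F n x)
    (fun n => 2 * `|d n x| + 4 * (0 * e n))) => [n|n||y Xy].
- by rewrite Fsym; have [] := bump n => // s t; rewrite subrr normr0 mul0r.
- by rewrite Fsym; have [] := bump n => // s t; rewrite subrr normr0 mul0r.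
- rewrite (_ : series _ = 2 *: series (fun n => `|d n x|)).
    by apply: is_cvgZr; exact: ks.
  apply/funext => n; rewrite !fctE !seriesEnat /= /GRing.scale /= mulr_sumr.
  by apply: eq_bigr => i _; rewrite mul0r mulr0 addr0.
- exact: SP.
Unshelve. all: by end_near. Qed.

End Diagonal.

(** * Random rounding to grids and its refinement *)

Section Rounding.
Variables (R : realType).

(* The expectation of [u Y], where [Y > x] is a point of the grid of step [1 / q]
   obtained from [x] by shifting it one step to the right and rounding it at
   random to a neighbour so that the mean is [x + 1 / q]. The range of
   summation is large enough for [|q * x| <= c]. *)
Definition rounding (Z : normedModType R) (q : R) (c : nat) (u : R -> Z) (x : R) :=
  \sum_(j < c.*2.+2) hat (q * x + c%:R - j%:R) *: u ((j%:R - c%:R + 1) / q).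

(** The same expectation in closed form and without truncation. The finite sum in [rounding] serves
    to prove continuity in [x], this form to prove estimates. *)
Definition rounding_mean (q : R) (v : R -> R) (x : R) :=
  let k := (Num.floor (q * x))%:~R in let theta := q * x - k in
  (1 - theta) * v ((k + 1) / q) + theta * v ((k + 2) / q).

Lemma roundingE (Z : normedModType R) (q x : R) (c : nat) (u : R -> Z) :
  `|q * x| <= c%:R ->
  let k := (Num.floor (q * x))%:~R in let theta := q * x - k in
  rounding q c u x =
    (1 - theta) *: u ((k + 1) / q) + theta *: u ((k + 2) / q).
Proof.
move=> /=; rewrite ler_norml => /andP[cx xc].
have /andP[kx xk] := floor_itv (q * x); rewrite intrD in xk.
have kc : - c%:Z <= Num.floor (q * x).
  by rewrite floor_ge_int intrN.
(* Summation indices are grid indices shifted by [c], so that they are natural numbers. *)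
have [i iE] : exists i : nat, Num.floor (q * x) = i%:Z - c%:Z.
  by exists (absz (Num.floor (q * x) + c%:Z)); lia.
rewrite iE intrB /intmul in kx xk *; set th := q * x - _.
have th01 : 0 <= th <= 1 by rewrite /th; apply/andP; lra.
rewrite /rounding.
under eq_bigr => j _.
  rewrite (_ : q * x + c%:R = i%:R + th); last by rewrite /th; ring.
  over.
rewrite (sum_hat (fun j => u ((j%:R - c%:R + 1) / q)))//.
  by rewrite -natr1; congr (_ + _ *: u (_ / _)); ring.
have : i%:R <= (c.*2)%:R :> R by rewrite -addnn natrD; lra.
by rewrite ler_nat !ltnS.
Qed.

Lemma rounding_grid (q x : R) : 0 < q ->
  let k := (Num.floor (q * x))%:~R in let theta := q * x - k in
  [/\ 0 <= theta, theta < 1, x <= (k + 1) / q & (k + 2) / q <= x + 2 / q].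
Proof.
move=> q0 /=; have /andP[kx xk] := floor_itv (q * x); rewrite intrD in xk.
split; try lra.
  by rewrite ler_pdivlMr//; lra.
by rewrite ler_pdivrMr// mulrDl divfK ?gt_eqF//; lra.
Qed.

(* The roundings at steps [1 / q] and [1 / (2 q)] are coupled so that the finer
   one never exceeds the coarser one. *)
Lemma rounding_refine (Z : normedModType R) (q x d : R) (c c' : nat)
    (u : R -> Z) (v : R -> R) :
  0 < q -> `|q * x| <= c%:R -> `|2 * q * x| <= c'%:R -> 2 / q <= d ->
  (forall s t, x <= s -> s <= t -> t <= x + d -> `|u t - u s| <= v t - v s) ->
  `|rounding (2 * q) c' u x - rounding q c u x| <=
    rounding_mean q v x - rounding_mean (2 * q) v x.
Proof.
move=> q0 xc xc' qd uv.
have [th0 th1 xB Dx] := rounding_grid x q0.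
rewrite !roundingE// /rounding_mean.
move: (floor_itv (q * x)); rewrite intrD => /andP[kx xk].
set k := (Num.floor (q * x))%:~R in kx xk th0 th1 xB Dx *.
set th := q * x - k in th0 th1 *.
have iq0 : 0 < q^-1 by rewrite invr_gt0.
have scale_le (a s t : R) : 0 <= a -> x <= s -> s <= t -> t <= x + d ->
    `|a *: (u s - u t)| <= a * (v t - v s).
  move=> a0 xs st tx; rewrite normrZ ger0_norm// distrC ler_wpM2l//.
  exact: uv.
have DE : (k + 2) / q = (k + 1) / q + q^-1 by ring.
(* The finer floor is [2 * k] or [2 * k + 1] according to the half of the cell that contains
   [q * x]. *)
have [th_lt|th_ge] := ltP th (1 / 2).
  have -> : (Num.floor (2 * q * x))%:~R = 2 * k.
    have -> : 2 * k = (2 * Num.floor (q * x))%:~R by rewrite intrM.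
    congr (_%:~R); apply: floor_def.
    by rewrite intrD intrM -/k /th in th_lt *; apply/andP; lra.
  have -> : (2 * k + 2) / (2 * q) = (k + 1) / q by field; rewrite gt_eqF.
  set A := (2 * k + 1) / (2 * q).
  have AE : A = (k + 1) / q - q^-1 / 2 by rewrite /A; field; rewrite gt_eqF.
  have xA : x <= A.
    by rewrite /A ler_pdivlMr ?mulr_gt0// /th in th_lt *; lra.
  have -> : 2 * q * x - 2 * k = 2 * th by rewrite /th; ring.
  move: xB Dx DE AE; set B := (k + 1) / q; set D := (k + 2) / q => xB Dx DE AE.
  (* Coupling from fine to coarse: mass [1 - 2 * th] goes from [A] to [B], mass [th] from [B] to
     [D], and mass [th] stays at [B]. *)
  have -> : (1 - 2 * th) *: u A + (2 * th) *: u B -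
      ((1 - th) *: u B + th *: u D) =
      (1 - 2 * th) *: (u A - u B) + th *: (u B - u D).
    rewrite [X in X - _]addrC opprD addrACA -scalerBl addrA.
    have -> : 2 * th - (1 - th) = th - (1 - 2 * th) by ring.
    rewrite scalerBl !scalerBr addrAC [RHS]addrC [RHS]addrA [RHS]addrAC.
    by congr (_ + _); rewrite addrAC.
  apply: le_trans (ler_normD _ _) _.
  apply: le_trans (lerD (scale_le _ _ _ _ _ _ _) (scale_le _ _ _ _ _ _ _)) _; lra.
have -> : (Num.floor (2 * q * x))%:~R = 2 * k + 1.
  have -> : 2 * k + 1 = (2 * Num.floor (q * x) + 1)%:~R by rewrite intrD intrM.
  congr (_%:~R); apply: floor_def.
  by rewrite !intrD intrM -/k /th in th_ge *; apply/andP; lra.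
have -> : (2 * k + 1 + 1) / (2 * q) = (k + 1) / q by field; rewrite gt_eqF.
set C := (2 * k + 1 + 2) / (2 * q).
have CE : C = (k + 1) / q + q^-1 / 2 by rewrite /C; field; rewrite gt_eqF.
have -> : 2 * q * x - (2 * k + 1) = 2 * th - 1 by rewrite /th; ring.
have -> : 1 - (2 * th - 1) = 2 - 2 * th by ring.
move: xB Dx DE CE; set B := (k + 1) / q; set D := (k + 2) / q => xB Dx DE CE.
(* Here mass [1 - th] goes from [B] to [D], mass [2 * th - 1] from [C] to [D], and mass [1 - th]
   stays at [B]. *)
have -> : (2 - 2 * th) *: u B + (2 * th - 1) *: u C -
    ((1 - th) *: u B + th *: u D) =
    (1 - th) *: (u B - u D) + (2 * th - 1) *: (u C - u D).
  rewrite opprD addrACA -scalerBl addrA.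
  rewrite !scalerBr addrACA -opprD -scalerDl.
  by congr (_ *: _ + _ - _ *: _); ring.
apply: le_trans (ler_normD _ _) _.
apply: le_trans (lerD (scale_le _ _ _ _ _ _ _) (scale_le _ _ _ _ _ _ _)) _; lra.
Qed.

End Rounding.

(** * From finite variation at the diagonal to absolute Baire-one maps *)

Section SecondVariable.
Variables (R : realType) (Z : normedModType R).
Implicit Types (X : set R) (f : R -> R -> Z) (g : R -> Z).

(** Each summand is a continuous weight times [f] at a fixed second argument, a grid point moved
    into [X] by [p]. *)
Lemma within_continuous_rounding X (p : R -> R) f (q : R) (c : nat) :
  (forall y, X (p y)) ->
  (forall y, X y -> {within X, continuous (fun x => f x y)}) ->
  {within X, continuous (fun x => rounding q c (fun y => f x (p y)) x)}.
Proof.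
move=> Xp fc; apply/subspace_continuousP => x Xx.
apply: cvg_big => [|j _]; first exact: add_continuous.
apply: cvgZ.
  apply: cvg_within_filter.
  apply: (@continuous_cvg _ _ _ _ _ (fun y => q * y + c%:R - j%:R) (@hat R)).
    exact: continuous_hat.
  apply: cvgB; last exact: cvg_cst.
  apply: cvgD; last exact: cvg_cst.
  by apply: cvgM; [exact: cvg_cst|exact: cvg_id].
have /subspace_continuousP := fc _ (Xp ((j%:R - c%:R + 1) / q)).
exact.
Qed.

Lemma finite_variation_diagonal_absolute_Baire_one X (x0 : R) f g :
  is_interval X -> X x0 -> has_diagonal X f g ->
  (forall y, X y -> {within X, continuous (fun x => f x y)}) ->
  (forall x, X x -> finite_variation_at X (f x) x /\
     f x t @[t --> within X (nbhs x)] --> f x x) ->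
  absolute_Baire_one X g.
Proof.
move=> X_itv Xx0 fg f1 f2.
have [p [Xp pX]] := right_retraction X_itv Xx0.
(* With this [c], the truncation has no effect at [x] once [|x| <= n]. *)
pose q n : R := 2 ^+ n; pose c n := (n * 2 ^ n)%N.
pose h n x := rounding (q n) (c n) (fun y => f x (p y)) x.
have q0 n : 0 < q n by rewrite exprn_gt0.
have qxc n x : `|x| <= n%:R -> `|q n * x| <= (c n)%:R.
  move=> xn; rewrite normrM (gtr0_norm (q0 n)) /c natrM natrX mulrC.
  by rewrite ler_wpM2r// ltW.
have fine x d : 0 < d -> \forall n \near \oo,
    [/\ `|x| <= n%:R, `|q n * x| <= (c n)%:R, `|q n.+1 * x| <= (c n.+1)%:R &
        2 / q n <= d].
  move=> d0; have d20 : 0 < d / 2 by rewrite divr_gt0.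
  near=> n; have xn : `|x| <= n%:R by near: n; exact: nbhs_infty_ger.
  have qd : `|0 - 2^-1 ^+ n| < d / 2.
    near: n; apply: cvgr_dist_lt => //.
    by apply: cvg_expr; rewrite ger0_norm; lra.
  rewrite sub0r normrN gtr0_norm ?exprn_gt0 ?invr_gt0// exprVn in qd.
  split=> //; first exact: qxc.
    by apply: qxc; apply: le_trans xn _; rewrite ler_nat.
  by rewrite -/(q n) in qd; lra.
exists h; split.
- by move=> n; exact: within_continuous_rounding.
- move=> x Xx; have [_ /cvgrPdist_le fx] := f2 _ Xx; rewrite fg// in fx.
  apply/cvgrPdist_le => e e0; have [r /= r0 rP] := fx _ e0.
  have [d d0 dP] := pX _ Xx.
  have u_close t : x <= t -> t <= x + Num.min d (r / 2) ->
      `|f x (p t) - g x| <= e.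
    rewrite -lerBlDl le_min !lerBlDl => xt /andP[td tr].
    have [xp _ pt] := dP _ _ xt (lexx t) td.
    rewrite distrC; apply: rP => //.
    by rewrite /ball /= ler0_norm; lra.
  have m0 : 0 < Num.min d (r / 2) by rewrite lt_min d0 divr_gt0.
  near=> n; have [_ xc _ qd] : [/\ `|x| <= n%:R, `|q n * x| <= (c n)%:R,
    `|q n.+1 * x| <= (c n.+1)%:R & 2 / q n <= Num.min d (r / 2)].
    by near: n; exact: fine.
  have [th0 th1 xB Dx] := rounding_grid x (q0 n).
  rewrite /h roundingE//; set th := q n * x - _ in th0 th1 *.
  set k := (_%:~R) in xB Dx *.
  have qV : 0 < (q n)^-1 by rewrite invr_gt0.
  have DE : (k + 2) / q n = (k + 1) / q n + (q n)^-1 by ring.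
  set B := (k + 1) / q n in xB DE *; set D := (k + 2) / q n in Dx DE *.
  (* The error is a convex combination of the errors at [p B] and [p D], both close to [x] from the
     right. *)
  have -> : g x - ((1 - th) *: f x (p B) + th *: f x (p D)) =
      - ((1 - th) *: (f x (p B) - g x) + th *: (f x (p D) - g x)).
    rewrite !scalerBr addrACA -opprD -scalerDl subrK scale1r.
    by rewrite [RHS]opprB.
  rewrite normrN; apply: le_trans (ler_normD _ _) _.
  rewrite !normrZ !ger0_norm; [|lra..].
  have -> : e = (1 - th) * e + th * e by ring.
  by apply: lerD; apply: ler_wpM2l; rewrite ?u_close//; lra.
- move=> x Xx; have [[a [b [ab abX [r /= r0 rP] fv]]] _] := f2 _ Xx.
  have [v0 v0P] := finite_variation_majorant fv.
  have [d' d'0 dP] := pX _ Xx; pose d := Num.min d' (r / 2).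
  have d0 : 0 < d by rewrite lt_min d'0 divr_gt0.
  pose v y := v0 (p y).
  have uv s t : x <= s -> s <= t -> t <= x + d ->
      `|f x (p t) - f x (p s)| <= v t - v s.
    rewrite -(lerBlDl t) le_min !lerBlDl => xs st /andP[td tr].
    have [xps pst pt] := dP _ _ xs st td.
    (* Points of [X] this close to [x] lie in the segment of finite variation, where the majorant
       [v0] is valid. *)
    have P z : x <= z -> z <= t -> X z -> a <= z <= b.
      move=> xz zt Xz; have := rP z; rewrite /= in_itv /=; apply=> //.
      by rewrite /ball /= ler0_norm; lra.
    have /andP[aps _] := P _ xps (le_trans pst pt) (Xp _).
    have /andP[_ ptb] := P _ (le_trans xps pst) pt (Xp _).
    exact: v0P.
  have [N _ NP] := fine x d d0.
  (* The steps telescope, and every mean is at least [v x] because [v] is nondecreasing to the right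
     of [x]. *)
  apply: (@is_cvg_series_bounded _ _ N (rounding_mean (q N) v x - v x)) => // n.
  have step i : (N <= i)%N -> `|h i.+1 x - h i x| <=
      rounding_mean (q i) v x - rounding_mean (q i.+1) v x.
    move=> Ni; have [_ xc xc' qd] := NP _ Ni.
    have qS : q i.+1 = 2 * q i by rewrite /q exprS.
    by rewrite /h qS; apply: rounding_refine qd uv => //; rewrite -qS.
  have lower i : (N <= i)%N -> v x <= rounding_mean (q i) v x.
    move=> Ni; have [_ xc xc' qd] := NP _ Ni.
    have [] := rounding_grid x (q0 i); rewrite /rounding_mean.
    set th := q i * x - _; set k := (_%:~R) => th0 th1 xB Dx.
    have qV : 0 < (q i)^-1 by rewrite invr_gt0.
    have DE : (k + 2) / q i = (k + 1) / q i + (q i)^-1 by ring.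
    have vge t : x <= t -> t <= x + d -> v x <= v t.
      move=> xt td; rewrite -subr_ge0.
      by apply: le_trans (uv x t _ xt td).
    have -> : v x = (1 - th) * v x + th * v x by ring.
    by apply: lerD; apply: ler_wpM2l; rewrite ?vge//; lra.
  have [nN|Nn] := leqP n N.
    by rewrite big_geq// subr_ge0 lower.
  apply: (@le_trans _ _ (rounding_mean (q N) v x - rounding_mean (q n) v x)).
    rewrite -opprB -(telescope_sumr (fun i => rounding_mean (q i) v x) (ltnW Nn)).
    rewrite -sumrN big_nat_cond [leRHS]big_nat_cond; apply: ler_sum => i.
    by move=> /andP[/andP[Ni _] _]; rewrite opprB; exact: step.
  by rewrite lerD2l lerN2 lower// ltnW.
Unshelve. all: by end_near. Qed.

End SecondVariable.

(** * Local consequences of absolute continuity *)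

Section AbsolutelyContinuous.
Variables (R : realType) (Z : normedModType R).
Implicit Types (X : set R) (h : R -> Z).

Lemma absolutely_continuous_on_cvg X h x : X x -> absolutely_continuous_on X h ->
  h t @[t --> within X (nbhs x)] --> h x.
Proof.
move=> Xx hX; apply/cvgrPdist_lt => e e0; have [d d0 dP] := hX _ e0.
have close s t : X s -> X t -> s < t -> t - s < d -> `|h t - h s| < e.
  move=> Xs Xt st sd.
  have := dP 1 (fun=> s) (fun=> t); rewrite !big_ord_recl !big_ord0 !addr0.
  by apply=> //; split.
exists d => // y /=; rewrite /ball /= => xy Xy.
have [xy'|yx|<-] := ltgtP x y; last by rewrite subrr normr0.
  by rewrite distrC close//; move: xy; rewrite ltr0_norm; lra.
by rewrite close//; move: xy; rewrite gtr0_norm; lra.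
Qed.

(** Supplies the right end of a short segment that is a neighbourhood of [x] in [X]; the left end
    comes from the reflected interval. If [x] is the maximum of [X], the end is [x] itself. *)
Lemma right_segment X (x d : R) : is_interval X -> X x -> 0 < d ->
  exists b, [/\ X b, x <= b, b <= x + d &
    exists2 r, 0 < r & forall y, X y -> y < x + r -> y <= b].
Proof.
move=> X_itv Xx d0; have [xX|] := pselect (forall y, X y -> y <= x).
  by exists x; split=> //; [lra|exists 1 => // y /xX].
move=> /existsNP[z /not_implyP[Xz /negP]]; rewrite -ltNge => xz.
exists (Num.min z (x + d)); split.
- by apply: X_itv Xx Xz _ _; rewrite le_min ge_min lexx; apply/andP; lra.
- by rewrite le_min; apply/andP; lra.
- by rewrite ge_min lexx orbT.
exists (Num.min (z - x) d); first by rewrite lt_min d0 subr_gt0 xz.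
move=> y _; rewrite -ltrBlDl lt_min => /andP[yz yd].
by rewrite le_min; apply/andP; lra.
Qed.

Lemma absolutely_continuous_on_finite_variation_at X h x :
  is_interval X -> X x -> absolutely_continuous_on X h ->
  finite_variation_at X h x.
Proof.
move=> X_itv Xx /(_ 1 ltr01)[d d0 dP].
(* Each half has length at most [d / 3], so the whole segment is shorter than [d] and the variation
   on it is at most 1. *)
have d30 : 0 < d / 3 by lra.
have [b [Xb xb bd [r r0 rP]]] := right_segment X_itv Xx d30.
have NX_itv : is_interval (X \o -%R).
  by move=> u w Xu Xw z zuw; apply: (X_itv _ _ Xw Xu); rewrite !lerN2 andbC.
have NXx : (X \o -%R) (- x) by rewrite /= opprK.
have [a [Xa xa ad [s s0 sP]]] := right_segment NX_itv NXx d30.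
have abX : `[- a, b] `<=` X.
  by move=> z /=; rewrite in_itv /=; exact: X_itv.
exists (- a), b; split=> //; first lra.
  exists (Num.min r s); first by rewrite /= lt_min r0.
  move=> y; rewrite /ball /= lt_min !ltr_norml => /andP[/andP[? ?] /andP[? ?]] Xy.
  rewrite in_itv /=; apply/andP; split.
    have := sP (- y); rewrite /= opprK => /(_ Xy); lra.
  by apply: rP => //; lra.
exists 1 => // n u w uw; apply/ltW/dP; first exact: sub_itv_collection uw.
apply: le_lt_trans (sum_increments_le (w := id) (lo := - a) (hi := b) _ _ _ uw) _;
  [by []| |lra|lra].
by move=> t /=; rewrite in_itv.
Qed.

End AbsolutelyContinuous.

Theorem theorem4p6 (R : realType) (Z : normedModType R) (X : set R)
    (X_itv : is_interval X) (g : R -> Z) :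
  [<->
    (exists f : R -> R -> Z,
       separately_absolutely_continuous X f /\ has_diagonal X f g);
    (exists f : R -> R -> Z,
       [/\ has_diagonal X f g,
           forall y, X y -> {within X, continuous (fun x => f x y)} &
           forall x, X x ->
             finite_variation_at X (f x) x /\
             f x t @[t --> within X (nbhs x)] --> f x x]);
    absolute_Baire_one X g].
Proof.
tfae.
- move=> [f [[f1 f2] fg]]; exists f; split=> // [y Xy|x Xx].
    by apply/subspace_continuousP => x Xx; exact/absolutely_continuous_on_cvg/f1.
  split; first exact/absolutely_continuous_on_finite_variation_at/f2.
  exact/absolutely_continuous_on_cvg/f2.
(* The constructions start from a point of [X]; for empty [X] the conditions hold vacuously. *)
- move=> [f [fg f1 f2]]; have [[x0 Xx0]|noX] := pselect (exists x, X x).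
    exact: finite_variation_diagonal_absolute_Baire_one X_itv Xx0 fg f1 f2.
  exists (fun _ _ => 0); split=> [n|x Xx|x Xx]; last 2 first.
    by case: noX; exists x.
    by case: noX; exists x.
  by apply/subspace_continuousP => x Xx; case: noX; exists x.
- have [[x0 Xx0]|noX] := pselect (exists x, X x).
    exact: absolute_Baire_one_diagonal X_itv Xx0.
  by move=> _; exists (fun _ _ => 0); split=> [|x Xx];
    [split=> x Xx|]; case: noX; exists x.
Qed.
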